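(* Let $\Omega$ be a centrally symmetric regular cell subdivision of the $n$-dimensional sphere $S^n$ such that identifying antipodal points yields a regular cell subdivision $\Omega'$ of the projective space $P^n$. Write $\Psi(\Omega)=\mathbf c^{n+1}+\Phi$. Then $$\Psi(\Omega')=\frac{\mathbf c^{n+1}+(\mathbf a-\mathbf b)^{n+1}}{2}+\frac{\Phi}{2}.$$
   Context: For a cell complex, $\Psi$ denotes the $\mathbf{ab}$-index of its face poset: the cells together with a minimum $\hat0$ (rank 0) and maximum $\hat1$ (rank $n+2$), ordered by $\tau<\sigma$ iff $\tau\subseteq\bar\sigma$, an $i$-cell having rank $i+1$. For $S=\{s_1<\dots<s_{k-1}\}\subseteq\{1,\dots,n+1\}$, $f_S$ counts chains $\hat0<x_1<\dots<x_{k-1}<\hat1$ with $\rho(x_j)=s_j$, $h_S=\sum_{T\subseteq S}(-1)^{|S-T|}f_T$, and $\Psi=\sum_Sh_Su_S\in\mathbb{Z}\langle\mathbf a,\mathbf b\rangle$ with $u_S=u_1\cdots u_{n+1}$, $u_i=\mathbf b$ if $i\in S$, else $\mathbf a$. $\mathbf c=\mathbf a+\mathbf b$. A regular cell complex has finitely many cells, each closed cell with its boundary homeomorphic to $(B^k,S^{k-1})$, and each boundary a disjoint union of smaller cells. *)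

(* Defs.v *)
From HB Require Import structures.
From mathcomp Require Import all_boot all_order all_algebra.
From mathcomp Require Import finmap generic_quotient.
(* The notations of monalg clash with those of MathComp-Analysis. *)
From mathcomp Require Import -(notations) monalg.
From mathcomp Require Import all_classical all_reals all_analysis.

Set Implicit Arguments.
Unset Strict Implicit.
Unset Printing Implicit Defensive.

Import Order.TTheory GRing.Theory Num.Theory.
Import numFieldNormedType.Exports.

Local Open Scope classical_set_scope.
Local Open Scope ring_scope.

(* The norm on 'rV[R]_k provided by the library is the sup norm, hence the
   explicit Euclidean one. *)
Definition sqnorm (R : realType) (k : nat) (x : 'rV[R]_k) : R :=
  \sum_(i < k) x 0 i ^+ 2.

Lemma sqnormN (R : realType) (k : nat) (x : 'rV[R]_k) : sqnorm (- x) = sqnorm x.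
Proof. by apply: eq_bigr => i _; rewrite mxE sqrrN. Qed.

Definition euclidean_ball (R : realType) (k : nat) : set 'rV[R]_k :=
  [set x | sqnorm x <= 1].

(* The unit sphere of R^k, of dimension k - 1; empty if k = 0. *)
Definition euclidean_sphere (R : realType) (k : nat) : set 'rV[R]_k :=
  [set x | sqnorm x = 1].

Arguments euclidean_ball : clear implicits.
Arguments euclidean_sphere : clear implicits.

Definition sphere (R : realType) (n : nat) : topologicalType :=
  set_type (euclidean_sphere R n.+1).

Section Antipodes.
Context (R : realType) (n : nat).

Lemma antipode_subproof (x : sphere R n) :
  - set_val x \in euclidean_sphere R n.+1.
Proof.
by apply/mem_set; rewrite /euclidean_sphere /= sqnormN; exact: set_valP x.
Qed.

Definition antipode (x : sphere R n) : sphere R n :=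
  exist _ (- set_val x) (antipode_subproof x).

Lemma antipodeK : involutive antipode.
Proof. by move=> x; apply: val_inj; rewrite /= opprK. Qed.

Definition antipodal (x y : sphere R n) : bool := (y == x) || (y == antipode x).

Lemma antipodal_refl : reflexive antipodal.
Proof. by move=> x; rewrite /antipodal eqxx. Qed.

Lemma antipodal_sym : symmetric antipodal.
Proof.
move=> x y; rewrite /antipodal [y == x]eq_sym; congr orb.
by apply/eqP/eqP => ->; rewrite antipodeK.
Qed.

Lemma antipodal_trans : transitive antipodal.
Proof.
move=> y x z /orP[/eqP->|/eqP->]; first exact: id.
case/orP => /eqP->; rewrite /antipodal.
  by rewrite eqxx orbT.
by rewrite antipodeK eqxx.
Qed.

Canonical antipodal_equiv :=
  EquivRel antipodal antipodal_refl antipodal_sym antipodal_trans.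

Definition projective_space : topologicalType :=
  quotient_topology {eq_quot antipodal_equiv}%qT.

Definition projection (x : sphere R n) : projective_space :=
  (\pi_{eq_quot antipodal_equiv} x)%qT.

End Antipodes.

Arguments antipode {R n}.
Arguments projection {R n}.

Definition homeomorphic_pairs (T U : topologicalType)
    (A A' : set T) (C C' : set U) : Prop :=
  exists (f : T -> U) (g : U -> T),
    [/\ {within A, continuous f}, {within C, continuous g}, f @` A = C,
        (forall x, A x -> g (f x) = x) & f @` A' = C'].

Section CellComplexes.
Context (R : realType) (X : topologicalType).

Definition cell_boundary (s : set X) : set X := closure s `\` s.

Definition is_cell (k : nat) (s : set X) : Prop :=
  homeomorphic_pairs (euclidean_ball R k) (euclidean_sphere R k)
                     (closure s) (cell_boundary s).

(* Such a k is unique by invariance of dimension. *)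
Definition cell_dim (s : set X) : nat := xget 0%N [set k | is_cell k s].

Record regular_cell_subdivision (Omega : set (set X)) : Prop := {
  rcs_finite : finite_set Omega;
  rcs_disjoint : trivIset Omega id;
  rcs_cover : \bigcup_(s in Omega) s = [set: X];
  rcs_cell : forall s, Omega s -> exists k, is_cell k s;
  rcs_boundary : forall s, Omega s ->
    exists2 D : set (set X),
      D `<=` [set t | Omega t /\ (cell_dim t < cell_dim s)%N] &
      cell_boundary s = \bigcup_(t in D) t }.

Inductive face : Type := FaceBot | FaceCell of set X | FaceTop.

HB.instance Definition _ := gen_eqMixin face.
HB.instance Definition _ := gen_choiceMixin face.

Context (n : nat) (Omega : set (set X)).

Definition face_poset : set face :=
  [set x | if x is FaceCell s then Omega s else True].

Definition face_lt (x y : face) : Prop :=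
  match x, y with
  | FaceBot, (FaceCell _ | FaceTop) => True
  | FaceCell t, FaceCell s => t `<=` closure s /\ t <> s
  | FaceCell _, FaceTop => True
  | _, _ => False
  end.

Definition face_rank (x : face) : nat :=
  match x with
  | FaceBot => 0
  | FaceCell s => (cell_dim s).+1
  | FaceTop => n.+2
  end.

(* Subsets of {1, ..., n+1} are represented by S : {set 'I_n.+1}, with i
   standing for the rank i.+1; enum S is increasing. *)
Definition chains (S : {set 'I_n.+1}) : set (seq face) :=
  [set c : seq face | [/\ (forall x, x \in c -> face_poset x),
               path (fun x y => `[< face_lt x y >]) FaceBot (rcons c FaceTop) &
               map face_rank c = [seq (val i).+1 | i <- enum S]]].

Definition flag_f (S : {set 'I_n.+1}) : nat := #|` fset_set (chains S)|.

Definition flag_h (S : {set 'I_n.+1}) : int :=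
  \sum_(T : {set 'I_n.+1} | T \subset S) (-1) ^+ #|S :\: T| * (flag_f T)%:Z.

End CellComplexes.

(* The free associative algebra K<a, b>: the monoid algebra over K of the
   free monoid on two letters, a = false and b = true. *)
Notation ab_algebra K := (malg (fmonom bool) K).

Definition ab_a (K : nzRingType) : ab_algebra K := mkmalgU (fmu false) 1.
Definition ab_b (K : nzRingType) : ab_algebra K := mkmalgU (fmu true) 1.
Definition ab_c (K : nzRingType) : ab_algebra K := ab_a K + ab_b K.

Definition ab_intr (p : ab_algebra int) : ab_algebra rat :=
  mmap (GRing.in_alg (ab_algebra rat) \o intr) (fun w => mkmalgU w 1) p.

Definition ab_index (R : realType) (X : topologicalType) (n : nat)
    (Omega : set (set X)) : ab_algebra int :=
  \sum_(S : {set 'I_n.+1})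
    flag_h R Omega S *: \prod_(i < n.+1) (if i \in S then ab_b int else ab_a int).

Definition centrally_symmetric (R : realType) (n : nat)
    (Omega : set (set (sphere R n))) : Prop :=
  forall s, Omega s -> Omega (antipode @` s).

Definition antipodal_quotient (R : realType) (n : nat)
    (Omega : set (set (sphere R n))) : set (set (projective_space R n)) :=
  [set projection @` s | s in Omega].

(* Main.v *)
(* A closed cell of Omega contains no pair of antipodal points.  Its image lies
   in a closed cell of the quotient, that is, in a homeomorphic image of a ball,
   over which the tautological line bundle is trivial: projecting a vector
   orthogonally from line to line along a radius of the ball gives a nowhere
   vanishing section.  The inner product of this section with the points of the
   closed cell is continuous and nowhere zero on a connected set, whereas it
   takes opposite values at antipodal points.

   Hence cells of Omega project homeomorphically, and once a lift of the
   smallest cell of a chain of the quotient is chosen, the rest of the chain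
   lifts in a unique way.  So f'_S = f_S / 2 for S nonempty, while f'_0 = f_0 = 1.
   This gives 2 h'_S = h_S + (-1)^|S|, and the sum of (-1)^|S| u_S is
   (a - b)^(n+1). *)
Require Import Defs.
From mathcomp Require Import all_boot all_order all_algebra.
From mathcomp Require Import finmap generic_quotient ring lra.
From mathcomp Require Import -(notations) monalg.
From mathcomp Require Import all_classical all_reals all_analysis.

Set Implicit Arguments.
Unset Strict Implicit.
Unset Printing Implicit Defensive.

Import Order.TTheory GRing.Theory Num.Theory.
Import numFieldNormedType.Exports.

Local Open Scope classical_set_scope.
Local Open Scope ring_scope.

(** * Homeomorphisms of pairs *)

Lemma within_continuous_comp (T U V : topologicalType) (A : set T) (B : set U)
    (f : T -> U) (g : U -> V) :
  {within A, continuous f} -> {within B, continuous g} -> f @` A `<=` B ->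
  {within A, continuous (g \o f)}.
Proof.
move=> /subspace_continuousP cf /subspace_continuousP cg fAB.
apply/subspace_continuousP => x Ax.
have Bfx : B (f x) by apply: fAB; exists x.
have fxB : f @ within A (nbhs x) --> within B (nbhs (f x)).
  move=> W nW; have := cf _ Ax _ nW; rewrite /nbhs /= /within /=.
  apply: filterS => y /= WB Ay.
  by apply: WB => //; apply: fAB; exists y.
exact: cvg_comp fxB (cg _ Bfx).
Qed.

Lemma homeomorphic_pairs_sym (T U : topologicalType) (A A' : set T)
    (C C' : set U) : A' `<=` A ->
  homeomorphic_pairs A A' C C' -> homeomorphic_pairs C C' A A'.
Proof.
move=> sA [f [g [cf cg fA gf fA']]]; exists g, f; split => //.
- rewrite -fA; apply/seteqP; split => [_ [_ [x Ax <-] <-]|x Ax].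
    by rewrite gf.
  by exists (f x); [exists x|rewrite gf].
- by rewrite -fA => _ [x Ax <-]; rewrite gf.
- rewrite -fA'; apply/seteqP; split => [_ [_ [x Ax <-] <-]|x Ax].
    by rewrite gf //; apply: sA.
  by exists (f x); [exists x|rewrite gf //; apply: sA].
Qed.

Lemma homeomorphic_pairs_trans (T U V : topologicalType) (A A' : set T)
    (C C' : set U) (E E' : set V) :
  homeomorphic_pairs A A' C C' -> homeomorphic_pairs C C' E E' ->
  homeomorphic_pairs A A' E E'.
Proof.
move=> [f [g [cf cg fA gf fA']]] [h [k [ch ck hC kh hC']]].
exists (h \o f), (g \o k); split.
- by apply: (within_continuous_comp cf ch); rewrite fA.
- apply: (within_continuous_comp ck cg) => _ [z Ez <-].
  by move: Ez; rewrite -hC => -[y Cy <-]; rewrite kh.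
- by rewrite -hC -fA image_comp.
- by move=> x Ax /=; rewrite kh ?gf // -fA; exists x.
- by rewrite -hC' -fA' image_comp.
Qed.

(** * The antipodal map and the projection to projective space *)

Section Projection.
Context (R : realType) (n : nat).
Implicit Types (x y : sphere R n) (A K s : set (sphere R n)).

Lemma set_val_antipode x : set_val (antipode x) = - set_val x.
Proof. by []. Qed.

Lemma sphere_sqnorm x : \sum_i (set_val x : 'rV[R]_n.+1) 0 i ^+ 2 = 1.
Proof. exact: set_valP x. Qed.

Lemma projectionP x y : projection x = projection y <-> y = x \/ y = antipode x.
Proof.
split => [xy|xy].
  have /orP[] : antipodal x y by apply/(eqmodP (antipodal_equiv R n)).
  - by move/eqP; left.
  - by move/eqP; right.
apply/(eqmodP (antipodal_equiv R n)); apply/orP.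
by case: xy => ->; [left|right].
Qed.

Lemma projection_antipode x : projection (antipode x) = projection x.
Proof. by apply/esym/projectionP; right. Qed.

Lemma projection_continuous : continuous (@projection R n).
Proof. exact: pi_continuous. Qed.

Lemma antipode_continuous : continuous (@antipode R n).
Proof.
have cval : continuous (set_val : sphere R n -> 'rV[R]_n.+1).
  exact: initial_continuous.
apply/continuousP => _ [B oB <-].
have -> : antipode @^-1` (set_val @^-1` B) =
    (set_val : sphere R n -> 'rV[R]_n.+1) @^-1` ((fun v => - v) @^-1` B).
  by [].
move/continuousP: cval; apply.
by move: B oB; apply/continuousP => v; exact: opp_continuous.
Qed.

Lemma antipode_imageE A : antipode @` A = antipode @^-1` A.
Proof.
apply/seteqP; split => [_ [x Ax <-]|x Ax]; rewrite /= ?antipodeK //.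
by exists (antipode x); rewrite ?antipodeK.
Qed.

Lemma antipode_image_eq A : antipode @` (antipode @` A) = A.
Proof. by rewrite !antipode_imageE; apply/seteqP; split => x; rewrite /= antipodeK. Qed.

Lemma closed_antipode A : closed A -> closed (antipode @` A).
Proof.
rewrite antipode_imageE; move: A; apply/continuous_closedP.
exact: antipode_continuous.
Qed.

(** The antipode is a closed map, which gives one inclusion; the other is that inclusion for the
    antipodal set, since the antipode is an involution. *)
Lemma closure_antipode A : closure (antipode @` A) = antipode @` closure A.
Proof.
suff sub (B : set (sphere R n)) :
    closure (antipode @` B) `<=` antipode @` closure B.
  apply/seteqP; split => //; rewrite -{1}(antipode_image_eq A) => _ [x hx <-].
  by have [y hy <-] := sub _ _ hx; rewrite antipodeK.
rewrite closureE; apply: smallest_sub; first exact/closed_antipode/closed_closure.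
by apply: image_subset; apply: subset_closure.
Qed.

Lemma projection_preimage_image A :
  projection @^-1` (projection @` A) = A `|` antipode @` A.
Proof.
apply/seteqP; split => x /=.
  by move=> [y Ay /projectionP[->|->]]; [left|right; exists y].
move=> [Ax|[y Ay <-]]; first by exists x.
by exists y => //; rewrite projection_antipode.
Qed.

Lemma projection_image_antipode A : projection @` (antipode @` A) = projection @` A.
Proof.
rewrite image_comp; apply/seteqP; split => _ [x Ax <-]; exists x => //=;
  by rewrite projection_antipode.
Qed.

(** In the quotient topology it suffices that the saturation of [A] is closed, and this is the union
    of [A] and its antipodal set. *)
Lemma projection_closed A : closed A -> closed (projection @` A).
Proof.
move=> cA; rewrite -openC.
suff : open (projection @^-1` ~` (projection @` A)) by [].
rewrite preimage_setC openC -[X in closed X]/(projection @^-1` (projection @` A)).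
rewrite projection_preimage_image.
by apply: closedU => //; exact: closed_antipode.
Qed.

(** Closedness of the projection gives one inclusion, continuity the other. *)
Lemma closure_projection A : closure (projection @` A) = projection @` closure A.
Proof.
apply/seteqP; split.
  rewrite closureE; apply: smallest_sub.
    exact/projection_closed/closed_closure.
  by apply: image_subset; apply: subset_closure.
move=> _ [x clx <-].
suff : closure A `<=` projection @^-1` closure (projection @` A) by apply.
rewrite closureE; apply: smallest_sub.
  move/continuous_closedP: projection_continuous; apply.
  exact: closed_closure.
by move=> y Ay; apply: subset_closure; exists y.
Qed.

End Projection.

(** * Euclidean balls and uniform continuity *)

Lemma continuous_sum (R : realType) (T : topologicalType) (I : Type) (r : seq I)
    (F : I -> T -> R) :
  (forall i, continuous (F i)) -> continuous (fun x => \sum_(i <- r) F i x).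
Proof.
by move=> cF; apply: continuous_big => // -[x y]; exact: cvgD cvg_fst cvg_snd.
Qed.

Section BallLemmas.
Context (R : realType) (k : nat).
Implicit Types u v : 'rV[R]_k.

Lemma sqr_coord_le_sqnorm u i : u 0 i ^+ 2 <= sqnorm u.
Proof.
rewrite /sqnorm (bigD1 i) //= lerDl; apply: sumr_ge0 => j _; exact: sqr_ge0.
Qed.

Lemma euclidean_ball_norm u : euclidean_ball R k u -> `|u| <= 1.
Proof.
move=> u1; rewrite [leLHS]/Num.Def.normr/= mx_normrE (bigmax_le _ ler01)//= => -[i j] _ /=.
rewrite ord1 -(@ler_pXn2r _ 2) ?nnegrE ?normr_ge0 // expr1n -normrX ger0_norm ?sqr_ge0 //.
exact: le_trans (sqr_coord_le_sqnorm u j) u1.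
Qed.

Lemma sqnorm_continuous : continuous (@sqnorm R k).
Proof.
apply: continuous_sum => i u.
by apply: (@cvgM _ _ (nbhs u)); exact: coord_continuous.
Qed.

Lemma euclidean_ball_compact : compact (euclidean_ball R k).
Proof.
apply: bounded_closed_compact.
  exists 1; split; first exact: num_real.
  by move=> x x1 u /euclidean_ball_norm u1; apply: le_trans u1 (ltW x1).
have -> : euclidean_ball R k = @sqnorm R k @^-1` [set x | x <= 1] by [].
move/continuous_closedP: sqnorm_continuous; apply; exact: closed_le.
Qed.

Lemma euclidean_ball_scale (c : R) u : 0 <= c <= 1 ->
  euclidean_ball R k u -> euclidean_ball R k (c *: u).
Proof.
move=> /andP[c0 c1]; rewrite /euclidean_ball /= /sqnorm => u1.
under eq_bigr do rewrite mxE exprMn.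
rewrite -mulr_sumr; apply: mulr_ile1 => //; first exact: sqr_ge0.
  by apply: sumr_ge0 => i _; exact: sqr_ge0.
exact: exprn_ile1.
Qed.

Lemma euclidean_ball_segment (c : R) u v : 0 <= c <= 1 ->
  euclidean_ball R k u -> euclidean_ball R k v ->
  euclidean_ball R k (u + c *: (v - u)).
Proof.
move=> /andP[c0 c1]; rewrite /euclidean_ball /= => u1 v1.
apply: (@le_trans _ _ ((1 - c) * sqnorm u + c * sqnorm v)); last by nra.
rewrite /sqnorm !mulr_sumr -big_split /=; apply: ler_sum => i _.
rewrite !mxE; set a := u 0 i; set b := v 0 i.
(* This is exactly the coordinatewise defect in the convexity of the square. *)
have : 0 <= c * (1 - c) * (a - b) ^+ 2.
  by rewrite mulr_ge0 ?sqr_ge0 // mulr_ge0 // subr_ge0.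
nra.
Qed.

End BallLemmas.

(** Heine-Cantor for a finite family at once: compactness, as near-covering, turns the moduli of
    continuity at single points into one [d]. *)
Lemma compact_uniform_continuous (R : realType) (V : normedModType R)
    (I : finType) (A : set V) (q : I -> V -> R) (e : R) :
  compact A -> (forall i, {within A, continuous (q i)}) -> 0 < e ->
  \forall d \near 0^'+, forall s t, A s -> A t -> `|s - t| < d ->
    forall i, `|q i s - q i t| < e.
Proof.
move=> cA cq e0.
have : \forall d \near (0 : R)^'+, A `<=` [set t | forall s, A s -> `|s - t| < d ->
    forall i, `|q i s - q i t| < e].
  move/compact_near_coveringP/near_covering_withinP : cA; apply => x Ax.
  have nx : \forall y \near x, forall i, A y -> `|q i y - q i x| < e / 2.
    apply: filter_forall => i.
    have e2 : 0 < e / 2 by rewrite divr_gt0.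
    have /subspace_continuousP/(_ x Ax)/cvgrPdistC_lt/(_ _ e2) := cq i.
    by rewrite near_withinE.
  move/nbhs_normP : nx => [r /= r0 hr].
  (* With half the radius for both, [t] near [x] and [s] near [t] still leave [s] within [r] of
     [x]. *)
  exists (ball x (r / 2), [set d | d < r / 2]) => /=.
    split; first by apply: nbhsx_ballx; rewrite divr_gt0.
    by apply: nbhs_right_lt; rewrite divr_gt0.
  move=> [t d] /= [xt dr] At s As std i.
  have {}xt : `|x - t| < r / 2 by rewrite -ball_normE in xt.
  have h1 : `|q i t - q i x| < e / 2.
    by apply: hr => //=; apply: lt_trans xt _; lra.
  have h2 : `|q i s - q i x| < e / 2.
    apply: hr => //=; have := ler_distD t x s; rewrite (distrC t s); lra.
  have := ler_distD (q i x) (q i s) (q i t); rewrite (distrC (q i x) (q i t)); lra.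
by apply: filterS => d h s t As At; apply: h.
Qed.

(** * Orthogonal projectors onto lines *)

Section LineProjector.
Context (R : realType) (n : nat).
Local Notation coord x := (set_val x : 'rV[R]_n.+1).
Implicit Types (x y : sphere R n) (p : projective_space R n).

(** The matrix of the orthogonal projection onto the line [p]. It is quadratic in the
    representative, so the sign chosen by [repr] cancels. *)
Definition projector (p : projective_space R n) (l j : 'I_n.+1) : R :=
  coord (repr p) 0 l * coord (repr p) 0 j.

Lemma projectorE x l j : projector (projection x) l j = coord x 0 l * coord x 0 j.
Proof.
rewrite /projector.
have /projectionP [->|->] // : projection x = projection (repr (projection x)).
  by rewrite /projection reprK.
by rewrite set_val_antipode !mxE mulrNN.
Qed.

Lemma sphere_coord_continuous i : continuous (fun x => coord x 0 i).
Proof.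
move=> x; apply: (@continuous_comp _ _ _ (fun x => coord x) (fun v : 'rV_n.+1 => v 0 i)).
  exact: initial_continuous.
exact: coord_continuous.
Qed.

Lemma projector_continuous l j : continuous (fun p => projector p l j).
Proof.
apply/quotient_continuous.
rewrite [X in continuous X](_ : _ = fun x => coord x 0 l * coord x 0 j); last first.
  by apply/funext => x; exact: projectorE.
by move=> x; apply: (@cvgM _ _ (nbhs x)); exact: sphere_coord_continuous.
Qed.

Definition inner x y : R := \sum_i coord x 0 i * coord y 0 i.

Lemma innerxx x : inner x x = 1.
Proof. by rewrite -(sphere_sqnorm x); apply: eq_bigr => i _; rewrite expr2. Qed.

Lemma sphere_coord_le1 x j : `|coord x 0 j| <= 1.
Proof.
rewrite -(@ler_pXn2r _ 2) ?nnegrE ?normr_ge0 // expr1n -normrX ger0_norm ?sqr_ge0 //.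
by rewrite -(sphere_sqnorm x); exact: sqr_coord_le_sqnorm.
Qed.

(** The matrices have [n.+1 ^ 2] entries, so the entries of the difference sum to less than 1 in
    absolute value. *)
Definition projector_close p p' : Prop :=
  forall lj : 'I_n.+1 * 'I_n.+1,
    `|projector p lj.1 lj.2 - projector p' lj.1 lj.2| < (n.+1 ^ 2)%:R^-1.

(** For orthogonal [x] and [y] the difference of the projectors, as a quadratic form, takes the
    value -1 at [y]; close projectors only allow values of modulus below 1 at unit vectors. *)
Lemma projector_close_inner x y :
  projector_close (projection x) (projection y) -> inner x y != 0.
Proof.
move=> xy; apply/eqP => xy0.
pose d lj := projector (projection x) lj.1 lj.2 - projector (projection y) lj.1 lj.2.
have : \sum_(lj : 'I_n.+1 * 'I_n.+1) coord y 0 lj.1 * coord y 0 lj.2 * d lj = -1.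
  transitivity (inner x y ^+ 2 - inner y y ^+ 2); last first.
    by rewrite xy0 innerxx; ring.
  rewrite !expr2 /inner !mulr_suml -sumrB.
  rewrite -(pair_bigA _ (fun l j => coord y 0 l * coord y 0 j * d (l, j))) /=.
  apply: eq_bigr => l _; rewrite !mulr_sumr -sumrB; apply: eq_bigr => j _.
  by rewrite /d /= !projectorE; ring.
move=> /(congr1 Num.norm); rewrite normrN1; apply/eqP; rewrite lt_eqF //.
apply: le_lt_trans (ler_norm_sum _ _ _) _.
apply: (@lt_le_trans _ _ (\sum_(lj : 'I_n.+1 * 'I_n.+1) (n.+1 ^ 2)%:R^-1)).
  apply: ltr_sum => [|lj _]; first by apply/hasP; exists (ord0, ord0); rewrite ?mem_index_enum.
  apply: le_lt_trans (xy lj); rewrite normrM ler_piMl // normrM.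
  by apply: mulr_ile1; rewrite ?sphere_coord_le1.
by rewrite sumr_const card_prod card_ord -mulnn -(mulr_natl _^-1) divff // pnatr_eq0.
Qed.

(* Successive orthogonal projections of a vector spanning [p 0] onto the lines
   [p 1], ..., [p i]. *)
Fixpoint transport (p : nat -> projective_space R n) (i : nat) : 'I_n.+1 -> R :=
  if i is i'.+1 then
    fun j => \sum_l transport p i' l * projector (p i) l j
  else fun j => coord (repr (p 0)) 0 j.

(** Projecting c x onto the line of a unit vector y gives c <x, y> y, and <x, y> is nonzero when the
    two lines are close. *)
Lemma transport_neq0 (p : nat -> projective_space R n) (N : nat) :
  (forall i, (i < N)%N -> projector_close (p i) (p i.+1)) ->
  exists2 c, c != 0 & forall j, transport p N j = c * coord (repr (p N)) 0 j.
Proof.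
elim: N => [|N IH] pN; first by exists 1; rewrite ?oner_neq0 // => j; rewrite mul1r.
have [i iN|c c0 cE] := IH; first by apply: pN; rewrite ltnS ltnW.
exists (c * inner (repr (p N)) (repr (p N.+1))) => [|j].
  rewrite mulf_neq0 // projector_close_inner //.
  by rewrite /projection !reprK; exact: pN.
rewrite /= /inner mulr_sumr mulr_suml; apply: eq_bigr => l _.
by rewrite cE /projector; ring.
Qed.

End LineProjector.

(** * Absence of antipodal pairs in closed cells *)

Section AntipodalPairs.
Context (R : realType) (n k m : nat).
Context (f : 'rV[R]_k -> sphere R n) (phi : 'rV[R]_m -> projective_space R n)
  (psi : projective_space R n -> 'rV[R]_m).
Local Notation ballk := (euclidean_ball R k).
Local Notation ballm := (euclidean_ball R m).
Hypothesis f_cont : {within ballk, continuous f}.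
Hypothesis phi_cont : {within ballm, continuous phi}.
Hypothesis psi_cont : {within phi @` ballm, continuous psi}.
Hypothesis psiK : forall t, ballm t -> psi (phi t) = t.
Hypothesis f_lifts : projection @` (f @` ballk) `<=` phi @` ballm.

Let h u := psi (projection (f u)).

Let h_ball u : ballk u -> ballm (h u).
Proof.
move=> bu; have [|t bt E] := @f_lifts (projection (f u)).
  by exists (f u) => //; exists u.
by rewrite /h -E psiK.
Qed.

Let phi_h u : ballk u -> phi (h u) = projection (f u).
Proof.
move=> bu; have [|t bt E] := @f_lifts (projection (f u)).
  by exists (f u) => //; exists u.
by rewrite /h -E psiK.
Qed.

Let h_cont : {within ballk, continuous h}.
Proof.
apply: (within_continuous_comp (f := projection \o f) (B := phi @` ballm)) => //.
- apply: (within_continuous_comp (B := setT)) => //.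
  exact/continuous_subspaceT/projection_continuous.
- by rewrite -image_comp.
Qed.

(** The section of the tautological bundle is discretized: a vector is transported along finitely
    many points of the radius ending at [h u], and [F u] is its inner product with [f u]. *)
Lemma ball_image_antipode_free x : (f @` ballk) x -> ~ (f @` ballk) (antipode x).
Proof.
move=> [u bu fu] [v bv fv].
(* [N.+1] will be the number of equal steps on each radius; it must make consecutive lines close,
   uniformly over the ball. *)
have [N hN] : exists N : nat, forall s t, ballm s -> ballm t -> `|s - t| <= N.+1%:R^-1 ->
    projector_close (phi s) (phi t).
  pose q (lj : 'I_n.+1 * 'I_n.+1) (t : 'rV[R]_m) := projector (phi t) lj.1 lj.2.
  have qc lj : {within ballm, continuous (q lj)}.
    apply: (within_continuous_comp (B := setT)
      (g := fun p => projector p lj.1 lj.2) phi_cont) => //.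
    exact/continuous_subspaceT/projector_continuous.
  have e0 : 0 < (n.+1 ^ 2)%:R^-1 :> R by rewrite invr_gt0 ltr0n.
  have := compact_uniform_continuous (@euclidean_ball_compact R m) qc e0.
  move=> close_near.
  have [d [d0 hd]] := filter_ex (filterI (nbhs_right_gt (0 : R)) close_near).
  (* With this choice [N.+1] exceeds the inverse of [d]. *)
  exists (Num.truncn d^-1) => s t bs bt st; apply: hd => //.
  apply: le_lt_trans st _.
  by rewrite invf_plt ?posrE ?ltr0n // truncnS_gt.
(* All paths start at the same line [phi 0], so the initial vector does not depend on [u]; they end
   at the line of [f u]. *)
pose p u i : projective_space R n := phi ((i%:R / N.+1%:R) *: h u).
pose F u := \sum_j transport (p u) N.+1 j * (set_val (f u) : 'rV[R]_n.+1) 0 j.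
have frac_le1 i : (i <= N.+1)%N -> 0 <= (i%:R / N.+1%:R : R) <= 1.
  by move=> iN; rewrite divr_ge0 //= ler_pdivrMr ?ltr0n // mul1r ler_nat.
have F_neq0 w : ballk w -> F w != 0.
  move=> bw; have [i iN|c c0 cE] := @transport_neq0 _ _ (p w) N.+1.
    have hw i' : (i' <= N.+1)%N -> ballm ((i'%:R / N.+1%:R) *: h w).
      by move=> iN'; apply: euclidean_ball_scale; [exact: frac_le1|exact: h_ball].
    apply: hN; [by apply: hw; exact: ltnW|exact: hw|].
    (* Consecutive points differ by [h w] divided by [N.+1], and [h w] has norm at most 1. *)
    rewrite -scalerBl normrZ -mulrBl -natr1 opprD addNKr mulN1r normrN.
    rewrite ger0_norm ?invr_ge0 // ler_piMr ?invr_ge0 //.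
    exact/euclidean_ball_norm/h_ball.
  have pN : p w N.+1 = projection (f w) by rewrite /p divff ?pnatr_eq0 // scale1r phi_h.
  have -> : F w = c * inner (repr (p w N.+1)) (f w).
    by rewrite /F /inner mulr_sumr; apply: eq_bigr => j _; rewrite cE mulrA.
  rewrite mulf_neq0 //.
  (* The final representative is [f w] or its antipode, so the inner product is 1 or -1. *)
  have /projectionP[->|->] : projection (f w) = projection (repr (p w N.+1)).
    by rewrite /projection reprK.
  - by rewrite innerxx oner_neq0.
  - rewrite /inner; under eq_bigr do rewrite set_val_antipode mxE mulNr.
    by rewrite sumrN oppr_eq0 -/(inner _ _) innerxx oner_neq0.
(* Antipodal points have the same projection, hence the same path and transported vector; only the
   last factor changes sign. *)
have Fvu : F v = - F u.
  have huv : h v = h u by rewrite /h fv -fu projection_antipode.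
  rewrite /F /p huv -sumrN; apply: eq_bigr => j _.
  by rewrite fv -fu set_val_antipode mxE mulrN.
have transport_cont i j : (i <= N.+1)%N ->
    {within ballk, continuous (fun w => transport (p w) i j)}.
  have q_cont i' l j' : (i' <= N.+1)%N ->
      {within ballk, continuous (fun w => projector (p w i') l j')}.
    move=> iN; pose s w := (i'%:R / N.+1%:R : R) *: h w.
    have s_cont : {within ballk, continuous s}.
      move=> w; apply: cvgZr; exact: h_cont.
    have s_ball : s @` ballk `<=` ballm.
      by move=> _ [w bw <-]; apply: euclidean_ball_scale; [exact: frac_le1|exact: h_ball].
    apply: (within_continuous_comp (f := phi \o s) (B := setT)
      (g := fun p => projector p l j')) => //.
      exact: (within_continuous_comp s_cont phi_cont).
    exact/continuous_subspaceT/projector_continuous.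
  elim: i j => [|i IH] j iN.
    rewrite [X in continuous X](_ : _ = fun=> transport (fun=> phi 0) 0 j).
      exact: cst_continuous.
    apply/funext => w; have pw0 : p w 0%N = phi 0 by rewrite /p mul0r scale0r.
    by rewrite /from_subspace /= pw0.
  apply: continuous_sum => l w.
  apply: (@cvgM _ _ (nbhs w)); first by apply: IH; exact: ltnW.
  exact: q_cont.
have F_cont : {within ballk, continuous F}.
  apply: continuous_sum => j w.
  apply: (@cvgM _ _ (nbhs w)); first exact: transport_cont.
  move: w; apply: (within_continuous_comp (B := setT)
    (g := fun x => (set_val x : 'rV[R]_n.+1) 0 j) f_cont) => //.
  exact/continuous_subspaceT/sphere_coord_continuous.
pose s (t : R) := u + t *: (v - u).
have s_ball : s @` `[0, 1] `<=` ballk.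
  move=> _ [t /= + <-]; rewrite in_itv /= => t01.
  exact: euclidean_ball_segment.
have s_cont : continuous s.
  by move=> t; apply: cvgD; [exact: cvg_cst|apply: cvgZl; exact: cvg_id].
(* [F] takes opposite values at the ends of the segment from [u] to [v], which lies in the ball, so
   it would vanish in between. *)
have [||t t01 /eqP] := @IVT R (F \o s) 0 1 0 ler01.
- exact: within_continuous_comp (continuous_subspaceT s_cont) F_cont s_ball.
- rewrite /= /s scale0r addr0 scale1r subrKC Fvu.
  rewrite ge_min le_max oppr_ge0 oppr_le0; case: (leP (F u) 0) => //= F0.
  + by rewrite orbT.
  + by rewrite ltW.
- by apply/negP; apply: F_neq0; apply: s_ball; exists t.
Qed.

End AntipodalPairs.

(** * Sets without antipodal pairs project homeomorphically *)

Section ProjectionHomeomorphism.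
Context (R : realType) (n : nat) (K : set (sphere R n)).
Hypothesis K_closed : closed K.
Hypothesis K_free : forall x, K x -> ~ K (antipode x).

Lemma projection_inj_on x y : K x -> K y -> projection x = projection y -> x = y.
Proof. by move=> Kx Ky /projectionP[//|yE]; case: (K_free Kx); rewrite -yE. Qed.

(** The inverse is continuous because the projection is a closed map: it pulls a closed [C] back to
    the image of the closed set [C] intersected with [K]. *)
Lemma projection_homeomorphic_pairs (K' : set (sphere R n)) :
  homeomorphic_pairs K K' (projection @` K) (projection @` K').
Proof.
(* [repr p] is only a default value for points outside the image of [K]. *)
pose lift p := xget (repr p) [set x | K x /\ projection x = p].
have liftE x : K x -> lift (projection x) = x.
  move=> Kx; rewrite /lift; case: xgetP => [y _ [Ky yx]|nox]; last by case: (nox x).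
  exact: projection_inj_on.
exists projection, lift; split => //.
  exact/continuous_subspaceT/projection_continuous.
apply/continuous_closedP => C cC; apply/closed_subspaceP.
exists (projection @` (C `&` K)).
  by apply: projection_closed; exact: closedI.
apply/seteqP; split => p [/= Cp [x Kx px]]; rewrite -{}px in Cp *.
  case: Cp => y [Cy Ky] /(projection_inj_on Ky Kx) yx; rewrite yx in Cy.
  by split; [rewrite /preimage /from_subspace /= liftE|exists x].
move: Cp; rewrite /preimage /from_subspace /= liftE // => Cx.
by split; exists x.
Qed.

End ProjectionHomeomorphism.

(** * Cells and their closures *)

Lemma cell_neq0 (R : realType) (X : topologicalType) (k : nat) (s : set X) :
  is_cell R k s -> s !=set0.
Proof.
move=> [f [_ [_ _ fB _ _]]]; apply/set0P/eqP => s0.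
(* The centre of the ball is mapped into the closure, which would be empty if [s] were. *)
have : closure s (f 0).
  rewrite -fB; exists 0 => //; rewrite /euclidean_ball /= /sqnorm big1 ?ler01 // => i _.
  by rewrite mxE expr0n.
by rewrite s0 closure0.
Qed.

(** The case of two cells in [face_lt], convertible to it. *)
Definition cell_lt (X : topologicalType) (t s : set X) : Prop :=
  t `<=` closure s /\ t <> s.

Section Cells.
Context (R : realType) (X : topologicalType) (Omega : set (set X)).
Hypothesis HO : regular_cell_subdivision R Omega.

Lemma cells_eq s t x : Omega s -> Omega t -> s x -> t x -> s = t.
Proof.
move=> Os Ot sx tx.
by have := rcs_disjoint HO; move/trivIsetP => /(_ s t Os Ot) D;
  apply: contrapT => /eqP /D /seteqP[/(_ x) + _]; apply.
Qed.

(** The closure of [s] is [s] together with a union of cells, and disjointness forces the one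
    containing [x] to be [t]. *)
Lemma cell_sub_closure s t x : Omega s -> Omega t -> t x -> closure s x ->
  t `<=` closure s.
Proof.
move=> Os Ot tx clx; have [sx|nsx] := pselect (s x).
  by rewrite (cells_eq Ot Os tx sx); exact: subset_closure.
have [D DO DE] := rcs_boundary HO Os.
have : cell_boundary s x by split.
rewrite DE => -[t' Dt' t'x].
have -> : t = t' by apply: cells_eq tx t'x => //; case: (DO _ Dt').
by move=> y t'y; have [] : cell_boundary s y by rewrite DE; exists t'.
Qed.

End Cells.

(** * Cells of the sphere and cells of the quotient *)

Section AntipodalCells.
Context (R : realType) (n : nat) (Omega : set (set (sphere R n))).
Hypothesis HO : regular_cell_subdivision R Omega.
Hypothesis Hs : centrally_symmetric Omega.
Hypothesis HO' : regular_cell_subdivision R (antipodal_quotient Omega).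
Local Notation proj s := (projection @` s).
Local Notation anti s := (antipode @` s).

Lemma closed_cell_antipode_free s x : Omega s ->
  closure s x -> ~ closure s (antipode x).
Proof.
move=> Os; have [k [f [_ [cf _ fB _ _]]]] := rcs_cell HO Os.
have [|m [phi [psi [cphi cpsi phiB psiK _]]]] := rcs_cell HO' (s := proj s).
  by exists s.
rewrite -fB; apply: (ball_image_antipode_free cf cphi _ psiK).
- by rewrite phiB.
- by rewrite phiB fB closure_projection.
Qed.

Lemma anti_cell_neq s : Omega s -> anti s <> s.
Proof.
move=> Os E; have [k /cell_neq0[x sx]] := rcs_cell HO Os.
apply: (closed_cell_antipode_free Os (x := x)); apply: subset_closure => //.
by rewrite -E; exists x.
Qed.

(** Equal projections make [t] meet [s] or its antipodal cell, and cells that meet coincide. *)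
Lemma proj_cellP s t : Omega s -> Omega t ->
  proj s = proj t -> t = s \/ t = anti s.
Proof.
move=> Os Ot E; have [k /cell_neq0[x sx]] := rcs_cell HO Os.
have : proj t (projection x) by rewrite -E; exists x.
move=> [y ty /esym/projectionP[yx|yx]]; rewrite yx in ty.
- by left; apply: (cells_eq HO) ty sx.
- by right; apply: (cells_eq HO (x := antipode x) Ot (Hs Os) ty); exists x.
Qed.

Lemma cell_boundary_proj s : Omega s ->
  cell_boundary (proj s) = proj (cell_boundary s).
Proof.
move=> Os; rewrite /cell_boundary closure_projection.
apply/seteqP; split => [_ [[x clx <-] nsx]|_ [x [clx nsx] <-]].
  by exists x => //; split => // sx; apply: nsx; exists x.
split; first by exists x.
move=> [y sy] /(projection_inj_on (fun z => @closed_cell_antipode_free s z Os)) yx.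
by apply: nsx; rewrite -yx //; exact: subset_closure.
Qed.

(** The closed cell and its image are homeomorphic as pairs with their boundaries, so the same [k]
    qualify and [xget] picks the same one. *)
Lemma cell_dim_proj s : Omega s -> cell_dim R (proj s) = cell_dim R s.
Proof.
move=> Os; congr (xget 0%N _); apply/seteqP.
have homeo : homeomorphic_pairs (closure s) (cell_boundary s)
    (closure (proj s)) (cell_boundary (proj s)).
  rewrite cell_boundary_proj // closure_projection.
  apply: projection_homeomorphic_pairs; first exact: closed_closure.
  by move=> x; exact: closed_cell_antipode_free.
split => k /= kc; last exact: homeomorphic_pairs_trans kc homeo.
apply: homeomorphic_pairs_trans kc _.
by apply: homeomorphic_pairs_sym homeo => x [].
Qed.

Lemma cell_dim_anti s : Omega s -> cell_dim R (anti s) = cell_dim R s.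
Proof.
move=> Os; rewrite -cell_dim_proj; last exact: Hs.
by rewrite projection_image_antipode cell_dim_proj.
Qed.

Lemma cell_lt_anti (s t : set (sphere R n)) :
  cell_lt t s -> cell_lt (anti t) (anti s).
Proof.
move=> [ts nts]; split; last first.
  by move=> /(congr1 (fun A => anti A)); rewrite !antipode_image_eq.
by rewrite closure_antipode; exact: image_subset.
Qed.

Lemma cell_lt_anti_false s t : Omega s -> Omega t ->
  t `<=` closure s -> ~ (anti t `<=` closure s).
Proof.
move=> Os Ot ts ats; have [k /cell_neq0[x tx]] := rcs_cell HO Ot.
by apply: (closed_cell_antipode_free Os (ts _ tx)); apply: ats; exists x.
Qed.

(** Strictness survives because equal projections would make [s] antipodal to [t], and then
    [closure s] would contain both [t] and its antipodal cell. *)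
Lemma cell_lt_proj s t : Omega s -> Omega t ->
  cell_lt t s -> cell_lt (proj t) (proj s).
Proof.
move=> Os Ot [ts nts]; split.
  by rewrite closure_projection; exact: image_subset.
move=> /(proj_cellP Ot Os)[sE|sE]; first exact: nts.
apply: (cell_lt_anti_false Os Ot ts).
by rewrite -sE; exact: subset_closure.
Qed.

(** If [p] is the image of [s], a point of [t] lies in the closure of [s] or of its antipodal cell;
    the lift is chosen accordingly. *)
Lemma cell_lt_lift t p : Omega t -> antipodal_quotient Omega p ->
  cell_lt (proj t) p -> exists2 s, Omega s /\ proj s = p & cell_lt t s.
Proof.
move=> Ot [s Os <-] [ts nts].
have [k /cell_neq0[x tx]] := rcs_cell HO Ot.
have : closure (proj s) (projection x) by apply: ts; exists x.
have nt s' : proj s' = proj s -> t <> s' by move=> sE tE; apply: nts; rewrite tE.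
rewrite closure_projection => -[y cly /projectionP[xE|xE]].
- exists s => //; split; last exact: nt.
  by apply: (cell_sub_closure HO Os Ot tx); rewrite xE.
- have asE : proj (anti s) = proj s by exact: projection_image_antipode.
  exists (anti s); first by split => //; exact: Hs.
  split; last exact: nt.
  apply: (cell_sub_closure HO (Hs Os) Ot tx).
  by rewrite closure_antipode xE; exists y.
Qed.

(** Two different lifts would be antipodal, and then [closure s] would contain [t] and its antipodal
    cell. *)
Lemma cell_lt_lift_unique t s s' : Omega t -> Omega s -> Omega s' ->
  cell_lt t s -> cell_lt t s' -> proj s = proj s' -> s = s'.
Proof.
move=> Ot Os Os' [ts _] [ts' _] /(proj_cellP Os Os')[->//|s'E].
case: (cell_lt_anti_false Os Ot ts).
move: ts'; rewrite s'E closure_antipode => /(@image_subset _ _ antipode _ _).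
by rewrite antipode_image_eq.
Qed.

End AntipodalCells.

(** * Finiteness and two-to-one counting *)

Lemma finite_set_seq_in (T : Type) (A : set T) (k : nat) : finite_set A ->
  finite_set [set l : seq T | size l = k /\ forall x, List.In x l -> A x].
Proof.
move=> fA; elim: k => [|k IH].
  by apply: (@sub_finite_set _ _ [set [::]]) => // l [/size0nil].
apply: (sub_finite_set _ (finite_image2 cons fA IH)) => -[|x l] [//= [lk] Al].
exists x; first by apply: Al; left.
by exists l => //; split => // y yl; apply: Al; right.
Qed.

(** A section [sec] of [f] puts [A] in bijection with pairs of a value and a boolean, the boolean
    telling whether [a] is applied. *)
Lemma card_fset_set_two_to_one (T U : choiceType) (f : T -> U) (a : T -> T) (A : set T) :
  finite_set A -> (forall x, A x -> A (a x)) ->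
  (forall x, A x -> f (a x) = f x) -> (forall x, A x -> a x <> x) ->
  (forall x y, A x -> A y -> f x = f y -> y = x \/ y = a x) ->
  #|` fset_set A| = (2 * #|` fset_set (f @` A)|)%N.
Proof.
move=> fA aA fa a_neq fib; rewrite fset_set_image //.
set F := fset_set A; set G := (f @` F)%fset.
have FE x : (x \in F) = `[< A x >] by rewrite in_fset_set // in_setE.
have secP u : u \in G -> exists x, A x /\ f x = u.
  by case/imfsetP => x /=; rewrite FE => /asboolP Ax ->; exists x.
pose sec (u : G) : T := sval (cid (secP _ (valP u))).
have secA u : A (sec u) by rewrite /sec; case: cid => x [].
have secK u : f (sec u) = val u by rewrite /sec; case: cid => x [].
pose g (ub : G * bool) := if ub.2 then a (sec ub.1) else sec ub.1.
have gA ub : A (g ub) by rewrite /g; case: ub.2 => //; exact: aA.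
have gf ub : f (g ub) = val ub.1 by rewrite /g; case: ub.2; rewrite ?fa ?secK.
have g_inj : injective g.
  move=> ub vc E; have uv : ub.1 = vc.1 by apply: val_inj; rewrite -!gf E.
  case: ub vc uv E => u b [v c] /= <- {v}; case: b c => -[] //.
  - by move=> /a_neq; case.
  - by move=> /esym /a_neq; case.
have FE' : F = [fset g ub | ub in {: G * bool}]%fset.
  apply/fsetP => x; rewrite FE; apply/asboolP/imfsetP => /= [Ax|[ub _ ->]]; last exact: gA.
  have fxG : f x \in G by apply/imfsetP; exists x => //=; rewrite FE; apply/asboolP.
  have [||->|->] := fib (sec [` fxG]%fset) x _ Ax; rewrite ?secK //.
  - by exists ([` fxG]%fset, false); rewrite ?inE.
  - by exists ([` fxG]%fset, true); rewrite ?inE.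
rewrite FE' card_imfset //= -cardE card_prod card_bool mulnC.
by rewrite cardfE.
Qed.

(** * Chains of faces *)

Lemma FaceCell_inj (X : topologicalType) : injective (@FaceCell X).
Proof. by move=> s t; case. Qed.

Definition face_map (X Y : topologicalType) (g : set X -> set Y) (x : face X) : face Y :=
  match x with
  | FaceBot => FaceBot Y
  | FaceCell s => FaceCell (g s)
  | FaceTop => FaceTop Y
  end.

Section Chains.
Context (R : realType) (X : topologicalType) (n : nat) (Omega : set (set X)).

Lemma finite_chains (S : {set 'I_n.+1}) : finite_set Omega ->
  finite_set (chains R Omega S).
Proof.
move=> fO; have fP : finite_set (face_poset Omega).
  apply: (@sub_finite_set _ _ ([set FaceBot X; FaceTop X] `|` (@FaceCell X) @` Omega)).
    by move=> [|s|] //=; [left; left|right; exists s|left; right].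
  by rewrite finite_setU; split; [exact: finite_set2|exact: finite_image].
apply: (sub_finite_set _ (finite_set_seq_in #|S| fP)) => c [cO _ cS]; split.
  by move/(congr1 size): cS; rewrite !size_map -cardE.
move=> x xc; apply: cO; elim: c xc {cS} => //= y c IH [->|/IH].
  by rewrite mem_head.
by rewrite in_cons orbC => ->.
Qed.

Lemma flag_f0 : flag_f R Omega (finset.set0 : {set 'I_n.+1}) = 1%N.
Proof.
rewrite /flag_f (_ : chains R Omega _ = [set [::]]).
  by rewrite fset_set1 cardfs1.
rewrite /chains enum_set0 /=; apply/seteqP; split => [c [_ _ /eqP]|c -> /=].
  by case: c.
split => //; rewrite andbT; exact/asboolP.
Qed.

(** The head lies above [FaceBot] and below the next entry, which excludes both extremes. *)
Lemma chains_head (x : face X) c (S : {set 'I_n.+1}) : chains R Omega S (x :: c) ->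
  exists2 s, Omega s & x = FaceCell s.
Proof.
move=> [/(_ x (mem_head _ _)) xO /= /andP[/asboolP Bx xc] _].
case: x xO Bx xc => // [s Os _ _|_ _]; first by exists s.
by case: c => [|y c] /= /andP[/asboolP].
Qed.

(** Serves both for the projection and for the antipodal action. *)
Lemma chains_map (Y : topologicalType) (Omega' : set (set Y)) (g : set X -> set Y)
    (S : {set 'I_n.+1}) c :
  (forall s, Omega s -> Omega' (g s)) ->
  (forall s, Omega s -> cell_dim R (g s) = cell_dim R s) ->
  (forall s t, Omega s -> Omega t -> cell_lt t s -> cell_lt (g t) (g s)) ->
  chains R Omega S c -> chains R Omega' S (map (face_map g) c).
Proof.
move=> gO gdim glt [cO cp cS]; split.
- by move=> _ /mapP[x xc ->]; have := cO x xc; case: x {xc} => //= s; exact: gO.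
- rewrite -[FaceBot Y]/(face_map g (FaceBot X)) -[FaceTop Y]/(face_map g (FaceTop X)).
  rewrite -map_rcons; apply: (homo_path_in (P := fun x => `[< face_poset Omega x >])) cp.
  + move=> x y /asboolP Px /asboolP Py /asboolP xy; apply/asboolP.
    by case: x y Px Py xy => [|s|] [|t|] //= Os Ot; exact: glt.
  + rewrite /= all_rcons; apply/and3P; split; [exact/asboolP|exact/asboolP|].
    by apply/allP => x /cO Px; apply/asboolP.
- rewrite -cS -map_comp; apply/eq_in_map => x /cO.
  by case: x => //= s /gdim ->.
Qed.

End Chains.

(** * Flag numbers of the quotient *)

Section FlagNumbers.
Context (R : realType) (n : nat) (Omega : set (set (sphere R n))).
Hypothesis HO : regular_cell_subdivision R Omega.
Hypothesis Hs : centrally_symmetric Omega.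
Hypothesis HO' : regular_cell_subdivision R (antipodal_quotient Omega).
Local Notation face_proj := (face_map (fun s : set (sphere R n) => projection @` s)).
Local Notation face_anti := (face_map (fun s : set (sphere R n) => antipode @` s)).

Let face_ltb (X : topologicalType) (x y : face X) : bool := `[< face_lt x y >].

Lemma face_projP x y : face_poset Omega x -> face_poset Omega y ->
  face_proj x = face_proj y -> y = x \/ y = face_anti x.
Proof.
case: x y => [|s|] [|t|] //=; [by left| |by left].
by move=> Os Ot /FaceCell_inj /(proj_cellP HO Hs Os Ot)[]->; [left|right].
Qed.

(** Each entry is lifted above the lift of its predecessor; above [FaceBot] any lift will do. *)
Lemma path_face_lift x c' : face_poset Omega x ->
  (forall y, y \in c' -> face_poset (antipodal_quotient Omega) y) ->
  path (@face_ltb _) (face_proj x) (rcons c' (FaceTop _)) ->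
  exists c, [/\ forall y, y \in c -> face_poset Omega y, map face_proj c = c' &
    path (@face_ltb _) x (rcons c (FaceTop _))].
Proof.
elim: c' x => [|y c' IH] x Ox c'O /=.
  rewrite andbT => /asboolP xT; exists [::]; split => //=; rewrite andbT.
  by apply/asboolP; case: x xT {Ox}.
move=> /andP[/asboolP xy yc'].
have [z [Oz zy xz]] : exists z, [/\ face_poset Omega z, face_proj z = y & face_lt x z].
  have : face_poset (antipodal_quotient Omega) y by apply: c'O; exact: mem_head.
  case: x y xy {c'O yc'} Ox => [|t|] [|p|] //=.
  - by move=> _ _ [s Os <-]; exists (FaceCell s).
  - by exists (FaceTop _).
  - move=> tp Ot Op; have [s [Os sp] ts] := cell_lt_lift HO Hs Ot Op tp.
    by exists (FaceCell s); split => //=; rewrite sp.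
  - by exists (FaceTop _).
have [c [cO cE zc]] : exists c, [/\ forall y, y \in c -> face_poset Omega y,
    map face_proj c = c' & path (@face_ltb _) z (rcons c (FaceTop _))].
  by apply: IH => //; [move=> w wc; apply: c'O; rewrite in_cons wc orbT|rewrite zy].
exists (z :: c); split => /=; last by rewrite zc andbT; exact/asboolP.
- by move=> w; rewrite in_cons => /orP[/eqP->//|/cO].
- by rewrite cE zy.
Qed.

(** The bottom is excluded as a start because it lies below both lifts of a cell; above a cell each
    next lift is forced. *)
Lemma path_face_lift_unique x c d : x <> FaceBot _ -> face_poset Omega x ->
  (forall y, y \in c -> face_poset Omega y) ->
  (forall y, y \in d -> face_poset Omega y) ->
  path (@face_ltb _) x c -> path (@face_ltb _) x d ->
  map face_proj c = map face_proj d -> c = d.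
Proof.
elim: c x d => [|y c IH] x [|z d] // xB Ox cO dO /= /andP[/asboolP xy yc].
move=> /andP[/asboolP xz zd] [yz cd].
have Oy : face_poset Omega y by apply: cO; exact: mem_head.
have Oz : face_poset Omega z by apply: dO; exact: mem_head.
have yzE : y = z.
  case: x y z xB Ox xy xz yz Oy Oz {IH cO dO yc zd} =>
    [|t|] [|s|] [|s'|] //= _ Ot ts ts' /FaceCell_inj E Os Os'.
  by rewrite (cell_lt_lift_unique HO Hs HO' Ot Os Os' ts ts' E).
rewrite -{z}yzE in dO xz zd yz Oz *; congr cons; apply: (IH y) => //.
- by move=> yB; move: xy; rewrite yB; case: (x).
- by move=> w wc; apply: cO; rewrite in_cons wc orbT.
- by move=> w wc; apply: dO; rewrite in_cons wc orbT.
Qed.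

Lemma chains_anti (S : {set 'I_n.+1}) c : chains R Omega S c -> chains R Omega S (map face_anti c).
Proof.
apply: chains_map => //; first by move=> s Os; exact: (cell_dim_anti HO Hs HO').
by move=> s t _ _; exact: cell_lt_anti.
Qed.

Lemma map_face_proj_anti c : map face_proj (map face_anti c) = map face_proj c.
Proof.
by rewrite -map_comp; apply: eq_map => -[|s|] //=; rewrite projection_image_antipode.
Qed.

Lemma chains_projE (S : {set 'I_n.+1}) :
  map face_proj @` chains R Omega S = chains R (antipodal_quotient Omega) S.
Proof.
apply/seteqP; split => [_ [c cS <-]|c' [c'O c'p c'S]].
  apply: chains_map cS => [s Os|s Os|s t Os Ot]; first by exists s.
  - exact: (cell_dim_proj HO HO').
  - exact: (cell_lt_proj HO Hs HO').
have [c [cO cE cp]] := @path_face_lift (FaceBot _) c' I c'O c'p.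
exists c => //; split => //; rewrite -c'S -cE -map_comp; apply/eq_in_map => x /cO.
by case: x => //= s Os; rewrite (cell_dim_proj HO HO').
Qed.

(** The antipode acts freely on nonempty chains, and its orbits are the fibres of the projection:
    the heads agree up to the antipode, and the head determines the rest. *)
Lemma flag_f_quotient (S : {set 'I_n.+1}) : S != finset.set0 ->
  flag_f R Omega S = (2 * flag_f R (antipodal_quotient Omega) S)%N.
Proof.
move=> S0; rewrite /flag_f -chains_projE.
have c_neq0 c : chains R Omega S c -> c <> [::].
  move=> [_ _] + c0; rewrite c0 => /(congr1 size) /esym/eqP.
  by rewrite size_map -cardE cards_eq0 (negPf S0).
have uniq x c d : chains R Omega S (x :: c) -> chains R Omega S (x :: d) ->
    map face_proj c = map face_proj d -> c = d.
  move=> xc xd; have [s Os xE] := chains_head xc.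
  move: xc xd => [cO /= /andP[_ cp] _] [dO /= /andP[_ dp] _].
  apply: (@path_face_lift_unique x) => //.
  - by rewrite xE.
  - by rewrite xE.
  - by move=> y yc; apply: cO; rewrite in_cons yc orbT.
  - by move=> y yc; apply: dO; rewrite in_cons yc orbT.
  - by move: cp; rewrite rcons_path => /andP[].
  - by move: dp; rewrite rcons_path => /andP[].
apply: (@card_fset_set_two_to_one _ _ _ (map face_anti)).
- by apply: finite_chains; exact: rcs_finite HO.
- by move=> c; exact: chains_anti.
- by move=> c _; exact: map_face_proj_anti.
- case=> [|x c] cS; first by case: (c_neq0 _ cS).
  have [s Os ->] := chains_head cS => -[sE _].
  exact: (anti_cell_neq HO HO' Os).
- case=> [|x c] [|y d] cS dS; try by [case: (c_neq0 _ cS)|case: (c_neq0 _ dS)].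
  move=> /= [xy cd]; have aS := chains_anti cS.
  have [||yx|yx] := @face_projP x y _ _ xy.
  + by case: cS => cO _ _; apply: cO; exact: mem_head.
  + by case: dS => dO _ _; apply: dO; exact: mem_head.
  + by left; rewrite yx in dS *; rewrite (uniq _ _ _ cS dS).
  (* Here [d] follows the antipodal head, so it is compared with the antipodal chain of [c]. *)
  + right; rewrite yx in dS *; congr cons; apply/esym/(uniq _ _ _ aS dS).
    by rewrite map_face_proj_anti.
Qed.

(** Doubling matches every term except that of the empty set, where both flag numbers are 1; there a
    sign is left over. *)
Lemma flag_h_quotient (S : {set 'I_n.+1}) :
  flag_h R (antipodal_quotient Omega) S *+ 2 = flag_h R Omega S + (-1) ^+ #|S|.
Proof.
rewrite /flag_h -sumrMnl (bigD1 finset.set0) ?finset.sub0set //=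
  [in RHS](bigD1 finset.set0) ?finset.sub0set //=.
rewrite !flag_f0 finset.setD0 mulr1 mulr2n addrAC; congr (_ + _ + _).
apply: eq_bigr => T /andP[_ T0]; rewrite (flag_f_quotient T0) PoszM.
by ring.
Qed.

End FlagNumbers.

(** * Words in the letters a and b *)

Lemma ab_intrD : {morph ab_intr : p q / p + q}.
Proof. exact: mmapD. Qed.

Lemma ab_intr_mul2n (p : ab_algebra int) : ab_intr (p *+ 2) = ab_intr p *+ 2.
Proof. by rewrite !mulr2n ab_intrD. Qed.

Section AbWords.
Context (m : nat).

Lemma malgU_scale (K : monomType) (G : nzRingType) (c : G) (w : K) :
  mkmalgU w c = c *: mkmalgU w 1.
Proof. by rewrite -mul_malgC malgM_def fgmulUU mulr1 mul1m. Qed.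

Lemma malgU_prod (K : monomType) (G : nzRingType) (c : 'I_m -> G) (w : 'I_m -> K) :
  \prod_(i < m) mkmalgU (w i) (c i) =
  (\prod_(i < m) c i) *: mkmalgU (\big[mmul/mone]_(i < m) w i) 1.
Proof.
rewrite -malgU_scale; elim/big_rec3: _ => // i x y z _ ->.
by rewrite malgM_def fgmulUU.
Qed.

(** The monomial u_S of the ab-index. *)
Definition ab_word (K : nzRingType) (S : {set 'I_m}) : ab_algebra K :=
  \prod_(i < m) (if i \in S then ab_b K else ab_a K).

Lemma ab_wordE (K : nzRingType) (S : {set 'I_m}) :
  ab_word K S = mkmalgU (\big[mmul/mone]_(i < m) fmu (i \in S)) 1.
Proof.
transitivity (\prod_(i < m) mkmalgU (fmu (i \in S)) (1 : K)).
  by apply: eq_bigr => i _; case: ifP.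
by rewrite malgU_prod big1_eq scale1r.
Qed.

Lemma ab_intr_scale (c : int) (S : {set 'I_m}) :
  ab_intr (c *: ab_word int S) = c%:~R *: ab_word rat S.
Proof. by rewrite !ab_wordE -malgU_scale /ab_intr mmapU /= mulr_algl. Qed.

(** Distributing the product picks a letter at each position, and each b contributes a factor [e].
    The cases 1 and -1 of [e] give the powers of c and of a - b. *)
Lemma ab_exprD (K : nzRingType) (e : K) :
  (ab_a K + e *: ab_b K) ^+ m = \sum_(S : {set 'I_m}) e ^+ #|S| *: ab_word K S.
Proof.
rewrite -[in LHS](card_ord m) -prodr_const.
transitivity (\prod_(i < m) \sum_(b : bool) mkmalgU (fmu b) (if b then e else 1)).
  by apply: eq_bigr => i _; rewrite big_bool addrC malgU_scale.
rewrite bigA_distr_bigA /=.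
(* Choices of letters are turned into subsets, the positions of b. *)
rewrite (reindex_onto (fun S : {set 'I_m} => [ffun i => i \in S])
  (fun f : {ffun 'I_m -> bool} => [set i | f i])%SET) /=; last first.
  by move=> f _; apply/ffunP => i; rewrite ffunE finset.inE.
apply: eq_big => [S|S _]; first by apply/eqP/setP => i; rewrite finset.inE ffunE.
rewrite malgU_prod ab_wordE -prodr_const [in RHS]big_mkcond /=.
by congr (_ *: mkmalgU _ _); apply: eq_bigr => i _; rewrite ffunE.
Qed.

(** The power is expanded into words first, so that only additivity of [ab_intr] and its value on
    scaled words are used. *)
Lemma ab_intr_exprD (e : int) :
  ab_intr ((ab_a int + e *: ab_b int) ^+ m) = (ab_a rat + e%:~R *: ab_b rat) ^+ m.
Proof.
rewrite !ab_exprD /ab_intr raddf_sum; apply: eq_bigr => S _.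
by rewrite -rmorphXn; exact: ab_intr_scale.
Qed.

Lemma ab_intr_exprc : ab_intr (ab_c int ^+ m) = ab_c rat ^+ m.
Proof. by have := ab_intr_exprD 1; rewrite !scale1r. Qed.

Lemma ab_intr_exprB :
  ab_intr ((ab_a int - ab_b int) ^+ m) = (ab_a rat - ab_b rat) ^+ m.
Proof. by have := ab_intr_exprD (-1); rewrite rmorphN1 !scaleN1r. Qed.

End AbWords.

Theorem theorem5p1 (R : realType) (n : nat) (Omega : set (set (sphere R n)))
    (Phi : ab_algebra int) :
  regular_cell_subdivision R Omega ->
  centrally_symmetric Omega ->
  regular_cell_subdivision R (antipodal_quotient Omega) ->
  ab_index R n Omega = ab_c int ^+ n.+1 + Phi ->
  ab_intr (ab_index R n (antipodal_quotient Omega)) =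
    2^-1 *: (ab_c rat ^+ n.+1 + (ab_a rat - ab_b rat) ^+ n.+1)
    + 2^-1 *: ab_intr Phi.
Proof.
move=> HO Hs HO' PhiE.
(* The doubled identity holds over the integers, coefficient by coefficient; the division by 2 takes
   place after the passage to rationals. *)
have : ab_index R n (antipodal_quotient Omega) *+ 2 =
    ab_c int ^+ n.+1 + Phi + (ab_a int - ab_b int) ^+ n.+1.
  rewrite -PhiE -(scaleN1r (ab_b int)) ab_exprD /ab_index -sumrMnl -big_split.
  apply: eq_bigr => S _ /=.
  by rewrite scalerMnl (flag_h_quotient HO Hs HO') scalerDl.
(* The powers are generalized because unification would unfold them. *)
move: (ab_intr_exprc n.+1) (ab_intr_exprB n.+1); move: {PhiE}(_ ^+ _) (_ ^+ _).
move: (ab_index R n _) => Psi C D <- <- /(congr1 ab_intr).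
rewrite ab_intr_mul2n !ab_intrD => E.
by rewrite -scalerDr addrAC -E -scaler_nat scalerA mulVf ?scale1r.
Qed.
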